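(* Let $D$ be a $b$-Noetherian domain. The following are equivalent. (i) $D$ is integrally closed. (ii) $D$ is completely integrally closed. (iii) $D$ is a $v$-domain. (iv) $D$ is a P$v$MD. (v) $D$ is a Krull domain.
   Context: Let $D$ be an integral domain with quotient field $K$. An overring of $D$ is a ring $T$ with $D\subseteq T\subseteq K$; a valuation overring is an overring which is a valuation domain. For each nonzero $D$-submodule $E$ of $K$ set $E^b:=\bigcap\{EV \mid V \text{ valuation overring of } D\}$. A quasi-$b$-ideal of $D$ is a nonzero ideal $I$ of $D$ with $I^b\cap D=I$. $D$ is $b$-Noetherian if the ascending chain condition holds on quasi-$b$-ideals of $D$; equivalently, for each nonzero ideal $I$ of $D$ there is a finitely generated ideal $F\subseteq I$ with $F^b=I^b$. For nonzero $D$-submodules $E$ of $K$, $(D:E):=\{x\in K\mid xE\subseteq D\}$, $E^{-1}:=(D:E)$, $E^v:=(D:(D:E))$, and $E^t:=\bigcup\{F^v\mid F\subseteq E,\ F \text{ a nonzero finitely generated fractional ideal}\}$. $D$ is a $v$-domain if $(FF^{-1})^v=D$ for every nonzero finitely generated fractional ideal $F$ (equivalently, $v$ is e.a.b.: $(FG)^v\subseteq (FH)^v$ implies $G^v\subseteq H^v$ for nonzero finitely generated fractional ideals $F,G,H$). $D$ is a P$v$MD (Prüfer $v$-multiplication domain) if $(FF^{-1})^t=D$ for every nonzero finitely generated fractional ideal $F$. Fields are regarded as Krull domains. *)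

(* Defs.v *)
From HB Require Import structures.
From mathcomp Require Import all_boot all_order all_algebra.
From mathcomp Require Import boolp classical_sets functions cardinality.

Set Implicit Arguments.
Unset Strict Implicit.
Unset Printing Implicit Defensive.

Import Order.TTheory GRing.Theory Num.Theory.

Local Open Scope classical_set_scope.
Local Open Scope ring_scope.

(* Throughout, D is an integral domain and K = {fraction D} is its quotient
   field.  Overrings, D-submodules and ideals are all represented as subsets of
   K, D itself being identified with its image in K. *)

Notation toK := (@FracField.tofrac _).

Definition base (D : idomainType) : set {fraction D} := range (@FracField.tofrac D).
Arguments base D _ : clear implicits.

Section Rings.
Variable D : idomainType.
Local Notation K := {fraction D}.

Definition subring (T : set K) : Prop :=
  [/\ T 1, forall x y, T x -> T y -> T (x - y)
    & forall x y, T x -> T y -> T (x * y)].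

Definition overring (T : set K) : Prop := subring T /\ base D `<=` T.

(* K is the quotient field of each overring of D, so the valuation domain
   condition "x or 1/x belongs to V for each nonzero x of the quotient field
   of V" is a condition on the elements of K. *)
Definition valuation_overring (V : set K) : Prop :=
  overring V /\ forall x : K, x != 0 -> V x \/ V x^-1.

Definition submodule (E : set K) : Prop :=
  [/\ E 0, forall x y, E x -> E y -> E (x + y)
    & forall (d : D) x, E x -> E (toK d * x)].

Definition nonzero (E : set K) : Prop := exists2 x, E x & x != 0.

Definition ideal (I : set K) : Prop := submodule I /\ I `<=` base D.

Definition fractional_ideal (F : set K) : Prop :=
  submodule F /\
  exists2 d : D, d != 0 & forall x, F x -> base D (toK d * x).

Definition finitely_generated (F : set K) : Prop :=
  exists (n : nat) (a : 'I_n -> K),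
    F = [set x | exists c : 'I_n -> D, x = \sum_(i < n) toK (c i) * a i].

Definition nonzero_fg_fractional_ideal (F : set K) : Prop :=
  [/\ fractional_ideal F, nonzero F & finitely_generated F].

(* The product of two additive subgroups consists of the finite sums of
   products, not only of the products of elements. *)
Definition prod_set (E F : set K) : set K :=
  [set x | exists (n : nat) (e f : 'I_n -> K),
     [/\ forall i, E (e i), forall i, F (f i)
       & x = \sum_(i < n) e i * f i]].

Definition colon (E F : set K) : set K :=
  [set x | forall y, F y -> E (x * y)].

Definition inv_set (E : set K) : set K := colon (base D) E.

Definition b_closure (E : set K) : set K :=
  \bigcap_(V in valuation_overring) prod_set E V.

Definition v_closure (E : set K) : set K :=
  colon (base D) (colon (base D) E).

Definition t_closure (E : set K) : set K :=
  \bigcup_(F in [set F | nonzero_fg_fractional_ideal F /\ F `<=` E])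
    v_closure F.

Definition quasi_b_ideal (I : set K) : Prop :=
  [/\ ideal I, nonzero I & b_closure I `&` base D = I].

(* A valuation is only meaningful on nonzero elements: the value of w at 0 is
   irrelevant and stands for infinity. *)
Definition normalized_discrete_valuation (w : K -> int) : Prop :=
  [/\ forall x y, x != 0 -> y != 0 -> w (x * y) = w x + w y,
      forall x y, x != 0 -> y != 0 -> x + y != 0 ->
        Num.min (w x) (w y) <= w (x + y)
    & exists2 x, x != 0 & w x = 1].

(* Discrete valuation rings with quotient field K; K itself is not one. *)
Definition discrete_valuation_ring (V : set K) : Prop :=
  exists2 w, normalized_discrete_valuation w
           & V = [set x | x = 0 \/ 0 <= w x].

End Rings.

Definition b_noetherian (D : idomainType) : Prop :=
  forall I : nat -> set {fraction D},
    (forall n, quasi_b_ideal (I n)) -> (forall n, I n `<=` I n.+1) ->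
    exists N : nat, forall n, (N <= n)%N -> I n = I N.

Definition integrally_closed (D : idomainType) : Prop :=
  forall x : {fraction D}, integralOver (@FracField.tofrac D) x -> base D x.

Definition completely_integrally_closed (D : idomainType) : Prop :=
  forall x : {fraction D},
    (exists2 d : D, d != 0 & forall n : nat, base D (toK d * x ^+ n)) ->
    base D x.

Definition v_domain (D : idomainType) : Prop :=
  forall F : set {fraction D}, nonzero_fg_fractional_ideal F ->
    v_closure (prod_set F (inv_set F)) = base D.

Definition PvMD (D : idomainType) : Prop :=
  forall F : set {fraction D}, nonzero_fg_fractional_ideal F ->
    t_closure (prod_set F (inv_set F)) = base D.

(* D is the intersection of a family of discrete valuation rings of K such that
   each nonzero element of D is a unit in all but finitely many of them.  The
   empty family, whose intersection is K, makes every field a Krull domain. *)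
Definition krull_domain (D : idomainType) : Prop :=
  exists W : set (set {fraction D}),
    [/\ forall V, W V -> discrete_valuation_ring V,
        base D = \bigcap_(V in W) V
      & forall x : {fraction D}, base D x -> x != 0 ->
          finite_set [set V | W V /\ ~ V x^-1]].

(* Main.v *)
Require Import Defs.
From mathcomp Require Import all_boot all_order all_algebra.
From mathcomp Require Import boolp classical_sets functions cardinality.
From mathcomp Require Import ring.

(** Two ideas carry the equivalence.

    The first is that the ascending chain condition on quasi-b-ideals reaches
    far more than finitely generated ideals.  Every nonzero ideal of the form
    D intersected with a family of modules over valuation overrings is a
    quasi-b-ideal ([quasi_b_ideal_bigcap]).  When D is integrally closed, D is
    the intersection of its valuation overrings
    ([valuation_overring_avoiding]), so all divisorial ideals of D are of this
    form ([quasi_b_ideal_colon]): D is then a Mori domain.  Complete integral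
    closedness follows by applying the chain condition to the ideals
    d (D + D x)^n, closed up valuation ring by valuation ring: if all d x^n lie
    in D, the chain stops at some N, whence x ^ (N + 1) lies in V + V x ^ N for
    every V, which forces x into V.  That v-domains are P-v-MDs is the statement
    that in a Mori domain each ideal has the same inverse as some finitely
    generated ideal inside it ([finite_type_inv_set]).  Conversely P-v-MDs are
    v-domains and v-domains are integrally closed.

    The second idea gives the Krull property without the theory of divisorial
    ideals.  For y outside D the ideal of denominators (D : y) within D is
    divisorial, so every such ideal is contained in a maximal one.  When
    P = (D : y) is maximal, y behaves like the inverse of a uniformizer of the
    localization D_P: complete integral closedness yields p in P with p y not
    in P, and the valuation of x is the unique integer n such that x y^n is a
    unit of D_P ([local_expP], [localization_dvr]).  An element x outside D is
    missing from D_P as soon as P contains (D : x), so these rings intersect in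
    D.  Finiteness is again the chain condition: the ideals D intersected with
    the x V, for V in a cofinite subset of the rings in which x is not a unit,
    have a maximal member, and removing the ring of y from the subset enlarges
    the ideal by x y; hence the empty subset is cofinite
    ([b_noetherian_krull_domain]).

    The existence of enough valuation overrings is obtained by Zorn's lemma
    directly on subrings that contain 1/x and avoid x
    ([exists_maximal_avoiding], [maximal_avoiding_valuation]). *)

Set Implicit Arguments.
Unset Strict Implicit.
Unset Printing Implicit Defensive.

Import Order.TTheory GRing.Theory Num.Theory.

Local Open Scope classical_set_scope.
Local Open Scope ring_scope.

(** * Subrings of the quotient field *)

Section Subrings.
Variable D : idomainType.
Local Notation K := {fraction D}.
Implicit Types (T V : set K) (x y z : K).

Section Closure.
Variables (T : set K) (ringT : subring T).

Lemma subring1 : T 1. Proof. by case: ringT. Qed.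

Lemma subringB x y : T x -> T y -> T (x - y).
Proof. by case: ringT => _ + _; apply. Qed.

Lemma subringM x y : T x -> T y -> T (x * y).
Proof. by case: ringT => _ _; apply. Qed.

Lemma subring0 : T 0.
Proof. by rewrite -(subrr 1); apply: subringB; exact: subring1. Qed.

Lemma subringN x : T x -> T (- x).
Proof.
by move=> Tx; rewrite -sub0r; apply: subringB => //; exact: subring0.
Qed.

Lemma subringD x y : T x -> T y -> T (x + y).
Proof.
by move=> Tx Ty; rewrite -(opprK y); apply: subringB => //; exact: subringN.
Qed.

Lemma subringX x n : T x -> T (x ^+ n).
Proof.
move=> Tx; elim: n => [|n IHn]; first by rewrite expr0; exact: subring1.
by rewrite exprS; exact: subringM.
Qed.

Lemma subring_sum n (F : 'I_n -> K) :
  (forall i, T (F i)) -> T (\sum_(i < n) F i).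
Proof.
by move=> TF; apply: (big_ind T) => //; [exact: subring0|exact: subringD].
Qed.

End Closure.

Lemma baseK (d : D) : base D (toK d). Proof. by exists d. Qed.

Lemma subring_base : subring (base D).
Proof.
split; first by exists 1; rewrite ?rmorph1.
- by move=> _ _ [a _ <-] [b _ <-]; exists (a - b); rewrite ?rmorphB.
- by move=> _ _ [a _ <-] [b _ <-]; exists (a * b); rewrite ?rmorphM.
Qed.

Lemma base_seq (f : nat -> K) : (forall i, base D (f i)) ->
  exists d : nat -> D, forall i, toK (d i) = f i.
Proof.
move=> Df; have /boolp.choice[d dE] : forall i, exists d, toK d = f i.
  by move=> i; have [d _ <-] := Df i; exists d.
by exists d.
Qed.

(** * Integral elements and adjunction *)

(** The T-module spanned by 1, z, ..., z^(n-1).  With it, integrality of z over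
    the subring T reads [power_span T z n (z ^+ n)] for some n; T being a mere
    subset of the field, this spares turning each subring into a ring type. *)
Definition power_span T z n : set K :=
  [set y | exists p : {poly K},
     [/\ forall i, T p`_i, (size p <= n)%N & y = p.[z]]].

Definition adjoin T z : set K := [set y | exists n, power_span T z n y].

Section Span.
Variables (T : set K) (ringT : subring T).

Lemma power_spanD z n x y :
  power_span T z n x -> power_span T z n y -> power_span T z n (x + y).
Proof.
move=> [p [Tp sp ->]] [q [Tq sq ->]]; exists (p + q); split.
- by move=> i; rewrite coefD; exact: subringD.
- by rewrite (leq_trans (size_polyD _ _))// geq_max sp.
- by rewrite hornerD.
Qed.

Lemma power_spanZ z n a x :
  T a -> power_span T z n x -> power_span T z n (a * x).
Proof.
move=> Ta [p [Tp sp ->]]; exists (a *: p); split.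
- by move=> i; rewrite coefZ; exact: subringM.
- exact: leq_trans (size_scale_leq _ _) sp.
- by rewrite hornerZ.
Qed.

Lemma power_span0 z n : power_span T z n 0.
Proof.
exists 0; split; rewrite ?size_poly0 ?horner0// => i.
by rewrite coef0; exact: subring0.
Qed.

Lemma power_span_splitP z n y :
  power_span T z n.+1 y <->
  exists c y', [/\ T c, power_span T z n y' & y = c * z ^+ n + y'].
Proof.
split.
- move=> [p [Tp sp ->]]; exists p`_n, (take_poly n p).[z]; split => //.
    exists (take_poly n p); split=> //; last exact: size_take_poly.
    move=> i; rewrite coef_take_poly; case: ifP => // _; exact: subring0.
  rewrite (horner_coef_wide _ sp) big_ord_recr/= addrC; congr (_ + _).
  rewrite (@horner_coef_wide _ n)  ?size_take_poly//.
  by apply: eq_bigr => i _; rewrite coef_take_poly ltn_ord.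
- move=> [c [_ [Tc [p [Tp sp ->]] ->]]]; exists (c *: 'X^n + p); split.
  + move=> i; rewrite coefD coefZ coefXn; apply: subringD => //.
    by apply: subringM => //; case: eqP => _; [exact: subring1|exact: subring0].
  + rewrite (leq_trans (size_polyD _ _))// geq_max (leqW sp) andbT.
    by rewrite (leq_trans (size_scale_leq _ _))// size_polyXn.
  + by rewrite hornerD hornerZ hornerXn.
Qed.

Lemma power_spanMz z n y : power_span T z n y -> power_span T z n.+1 (y * z).
Proof.
move=> [p [Tp sp ->]]; exists (p * 'X); split.
- by move=> i; rewrite coefMX; case: eqP => // _; exact: subring0.
- by rewrite (leq_trans (size_polyMleq _ _))// size_polyX addn2/=.
- by rewrite hornerMX.
Qed.

(** Multiplication by x^(1-n) maps the span of 1, ..., x^(n-1) onto the span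
    of 1, ..., x^-(n-1); it is written as x * x^-n so as to make sense, with
    both spans null, when n = 0. *)
Lemma power_span_inv x n y :
  x != 0 -> power_span T x n y -> power_span T x^-1 n (y * x * x^-1 ^+ n).
Proof.
move=> x0 [p [Tp sp ->]].
exists (\poly_(j < n) p`_(n.-1 - j)); split; first 2 last.
- rewrite (horner_coef_wide _ sp) (horner_coef_wide _ (size_poly _ _)).
  rewrite -mulrA mulr_suml (reindex_inj rev_ord_inj)/=; apply: eq_bigr => i _.
  rewrite coef_poly ltn_ord -predn_sub -subnS -mulrA; congr (_ * _).
  rewrite mulrA -exprSr -subSn// subSS exprVn.
  apply: (mulIf (expf_neq0 n x0)); rewrite mulfVK ?expf_neq0//.
  have -> : x ^+ n = x ^+ i * x ^+ (n - i).
    by rewrite -exprD subnKC// ltnW.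
  by rewrite mulrA exprVn mulVf ?mul1r// expf_neq0.
- move=> i; rewrite coef_poly; case: ifP => // _; exact: subring0.
- exact: size_poly.
Qed.

(** Multiplying an equation of integral dependence by x^(1-n) turns it into an
    expression of x as a polynomial in x^-1.  Hence x is integral over T exactly
    when it belongs to T[x^-1]. *)
Lemma integral_invP x n :
  x != 0 -> power_span T x n (x ^+ n) <-> power_span T x^-1 n x.
Proof.
move=> x0; split.
- move=> /(power_span_inv x0); rewrite mulrAC -exprMn divff// expr1n mul1r //.
- move=> /(power_span_inv (invr_neq0 x0)).
  by rewrite invrK divff// mul1r.
Qed.

Lemma power_span_sub z n : T z -> power_span T z n `<=` T.
Proof.
move=> Tz _ [p [Tp sp ->]]; rewrite horner_coef; apply: subring_sum => // i.
by apply: subringM => //; exact: subringX.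
Qed.

Lemma adjoin_subring z : subring (adjoin T z).
Proof.
split.
- exists 1%N, 1; split; rewrite ?size_poly1 ?hornerC// => i.
  by rewrite coef1; case: eqP => _; [exact: subring1|exact: subring0].
- move=> _ _ [n [p [Tp _ ->]]] [m [q [Tq _ ->]]].
  exists (size (p - q)), (p - q); split; rewrite ?hornerD ?hornerN// => i.
  by rewrite coefB; exact: subringB.
- move=> _ _ [n [p [Tp _ ->]]] [m [q [Tq _ ->]]].
  exists (size (p * q)), (p * q); split; rewrite ?hornerM// => i.
  by rewrite coefM; apply: subring_sum => // j; exact: subringM.
Qed.

Lemma sub_adjoin z : T `<=` adjoin T z.
Proof.
move=> a Ta; exists 1%N, a%:P; split; rewrite ?hornerC ?size_polyC ?leq_b1//.
by move=> i; rewrite coefC; case: eqP => // _; exact: subring0.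
Qed.

Lemma mem_adjoin z : adjoin T z z.
Proof.
exists 2%N, 'X; split; rewrite ?size_polyX ?hornerX// => i.
by rewrite coefX; case: eqP => _; [exact: subring1|exact: subring0].
Qed.

Lemma adjoin_integral z n :
  power_span T z n (z ^+ n) -> adjoin T z `<=` power_span T z n.
Proof.
move=> intz; have spanM y : power_span T z n y -> power_span T z n (y * z).
  move=> /power_spanMz/power_span_splitP[c [y' [Tc y'n ->]]].
  by apply: power_spanD => //; exact: power_spanZ.
have span1 : power_span T z n 1.
  case: n => [|n] in intz spanM *; first by rewrite expr0 in intz.
  exists 1; split; rewrite ?size_poly1 ?hornerC// => i.
  by rewrite coef1; case: eqP => _; [exact: subring1|exact: subring0].
have spanX i : power_span T z n (z ^+ i).
  by elim: i => // i IHi; rewrite exprSr; exact: spanM.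
move=> _ [m [p [Tp _ ->]]]; rewrite horner_coef.
apply: (big_ind (power_span T z n)); first exact: power_span0.
  exact: power_spanD.
move=> i _.
exact: power_spanZ.
Qed.

(** Nakayama's lemma for the finite module T[z]: the first hypothesis says that
    q lies in the Jacobson radical of T.  If q^-1 were in T[z], then
    q T[z] = T[z] would allow the last generator z^(n-1) to be dropped, again
    and again, until T[z] = 0. *)
Lemma integral_not_adjoin_inv q z n :
    (forall b, T b -> 1 - q * b != 0 /\ T (1 - q * b)^-1) ->
    T q -> q != 0 -> power_span T z n (z ^+ n) -> ~ adjoin T z q^-1.
Proof.
move=> unitT Tq q0 + qVz; elim: n => [|n IHn] intz.
  case: intz => p [_]; rewrite leqn0 size_poly_eq0 => /eqP->.
  by rewrite horner0 expr0 => /eqP; rewrite oner_eq0.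
have zn : adjoin T z (z ^+ n).
  by apply: subringX; [exact: adjoin_subring|exact: mem_adjoin].
have : power_span T z n.+1 (q^-1 * z ^+ n).
  by apply: adjoin_integral => //; apply: subringM; first exact: adjoin_subring.
move=> /power_span_splitP[c [y [Tc yn e]]]; apply: IHn.
have [u0 Tu] := unitT c Tc.
suff -> : z ^+ n = (1 - q * c)^-1 * q * y.
  by apply: power_spanZ => //; exact: subringM.
apply: (mulfI u0); rewrite -mulrA mulVKf//.
have -> : y = q^-1 * z ^+ n - c * z ^+ n by rewrite e addrC addKr.
by rewrite mulrBr mulVKf// mulrBl mul1r mulrA.
Qed.

End Span.

(** * Valuation overrings avoiding an element *)

Definition valuation_ring V := forall x, x != 0 -> V x \/ V x^-1.

Section MaximalAvoiding.
Variables (T : set K) (x : K) (ringT : subring T).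

Definition avoiding V := [/\ subring V, T `<=` V, V x^-1 & ~ V x].

(** Zorn's lemma is started at T[x^-1], which avoids x because x is not integral
    over T. *)
Lemma exists_maximal_avoiding : ~ (exists n, power_span T x n (x ^+ n)) ->
  exists2 V, avoiding V & forall W, avoiding W -> V `<=` W -> W `<=` V.
Proof.
move=> nintx.
have x0 : x != 0.
  apply/eqP => x0; apply: nintx; exists 1%N; rewrite x0 expr1.
  exact: power_span0.
have start : avoiding (adjoin T x^-1).
  split; [exact: adjoin_subring|exact: sub_adjoin|exact: mem_adjoin|].
  by move=> [n]; rewrite -integral_invP// => nx; apply: nintx; exists n.
(* The empty set is admitted because it is the union of the empty chain. *)
pose P W := W = set0 \/ avoiding W.
have [|V [PV Vmax]] := @Zorn_bigcup K P.
  move=> F FP Ftot.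
  case: (pselect (exists2 W, F W & W !=set0)) => [|F0]; last first.
    left; rewrite -subset0 => y [W FW Wy].
    by apply: F0; exists W => //; exists y.
  move=> [W0 FW0 W0n0]; right.
  have av W : F W -> W !=set0 -> avoiding W.
    by move=> /FP[->|//] [y []].
  have av' W y : F W -> W y -> avoiding W.
    by move=> FW Wy; apply: av => //; exists y.
  have [_ TW0 W0x _] := av _ FW0 W0n0.
  have pair y z : (\bigcup_(X in F) X) y -> (\bigcup_(X in F) X) z ->
      exists W, [/\ F W, W y & W z].
    move=> [A FA Ay] [B FB Bz]; have [AB|BA] := Ftot _ _ FA FB.
      by exists B; split => //; exact: AB.
    by exists A; split => //; exact: BA.
  split.
  - split.
    + by exists W0 => //; apply: subring1; case: (av _ FW0 W0n0).
    + move=> y z Fy Fz; have [W [FW Wy Wz]] := pair _ _ Fy Fz.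
      by exists W => //; apply: subringB => //; case: (av' W y FW Wy).
    + move=> y z Fy Fz; have [W [FW Wy Wz]] := pair _ _ Fy Fz.
      by exists W => //; apply: subringM => //; case: (av' W y FW Wy).
  - by move=> t Tt; exists W0 => //; exact: TW0.
  - by exists W0.
  - by move=> [W FW Wx]; case: (av' W x FW Wx).
case: PV => [V0|avV].
  exfalso; apply: (Vmax (adjoin T x^-1)); last by right.
  rewrite V0; split; first exact: sub0set.
  by move=> /(_ _ (mem_adjoin ringT x^-1)).
exists V => // W avW VW y Wy; apply: contrapT => Vy.
apply: (Vmax W); last by right.
by split=> // WV; apply: Vy; exact: WV.
Qed.

(** By maximality x lies in V[z] for every z outside V.  Applied to the inverses
    of 1 - x^-1 b, this shows that x^-1 is in the Jacobson radical of V.  If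
    neither z nor z^-1 is in V, then x in V[z^-1] makes z integral over V, and x
    in V[z] contradicts Nakayama's lemma. *)
Lemma maximal_avoiding_valuation V : x != 0 -> avoiding V ->
    (forall W, avoiding W -> V `<=` W -> W `<=` V) ->
  valuation_ring V.
Proof.
move=> x0 [ringV TV Vq Vx] Vmax.
have adjx z : ~ V z -> adjoin V z x.
  move=> Vz; apply: contrapT => nx; apply: Vz.
  apply: (Vmax (adjoin V z)); last exact: mem_adjoin.
    split => //; first exact: adjoin_subring.
      by move=> y /TV; exact: sub_adjoin.
    exact: sub_adjoin.
  exact: sub_adjoin.
have unitV b : V b -> 1 - x^-1 * b != 0 /\ V (1 - x^-1 * b)^-1.
  move=> Vb; have u0 : 1 - x^-1 * b != 0.
    apply/eqP => /eqP; rewrite subr_eq0 => /eqP e; apply: Vx.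
    by rewrite -(mulr1 x) e mulVKf.
  split=> //; set u := 1 - _ in u0 *.
  apply: contrapT => /adjx[n /power_span_inv -/(_ ringV)].
  rewrite invr_eq0 => /(_ u0); rewrite invrK.
  have Vu : V u by apply: subringB => //; [exact: subring1|exact: subringM].
  move=> /(power_span_sub ringV Vu).
  (* A power of u is congruent to 1 modulo x^-1 V, so that x u^n in V gives
     x in V. *)
  have [c Vc uc] : exists2 c, V c & u ^+ n = 1 - x^-1 * c.
    elim: n => [|n [c Vc IHn]].
      by exists 0; [exact: subring0|rewrite expr0 mulr0 subr0].
    exists (b + u * c); first by apply: subringD => //; exact: subringM.
    by rewrite exprS IHn mulrBr mulr1 {1}/u mulrDr opprD addrA mulrCA.
  move=> /(subringM ringV Vu); rewrite mulrA mulrCA divff// mulr1 uc.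
  rewrite mulrBr mulr1 mulVKf// => /(subringD ringV) /(_ Vc).
  by rewrite subrK.
move=> z z0; apply: contrapT => /not_orP[Vz VzV].
suff [n intz] : exists n, power_span V z n (z ^+ n).
  apply: (integral_not_adjoin_inv ringV unitV Vq _ intz).
    by rewrite invr_eq0.
  by rewrite invrK; exact: adjx.
case: (adjx _ VzV) => -[|n].
  case=> p [_]; rewrite leqn0 size_poly_eq0 => /eqP->; rewrite horner0.
  by move/eqP; rewrite (negbTE x0).
move=> [p [Vp sp xp]]; exists n; apply/integral_invP => //.
(* In x = p.[z^-1] the constant term is moved to the left: x u, with u a unit
   of V, is z^-1 times a polynomial in z^-1, and multiplying by z / (x u)
   expresses z as a polynomial in z^-1. *)
have [u0 Vu] := unitV _ (Vp 0%N); set u := 1 - _ in u0 Vu.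
exists (\poly_(i < n) (u^-1 * x^-1 * p`_i.+1)); split; last 1 first.
- apply: (mulfI u0).
  rewrite (horner_coef_wide _ (size_poly _ _)) mulr_sumr.
  have -> : u * z = x^-1 * \sum_(i < n) p`_i.+1 * z^-1 ^+ i.
    have : u = x^-1 * \sum_(i < n) p`_i.+1 * z^-1 ^+ i.+1.
      apply: (mulfI x0); rewrite mulVKf// /u mulrBr mulr1 mulVKf//.
      rewrite [in LHS]xp (horner_coef_wide _ sp) big_ord_recl/=.
      by rewrite expr0 mulr1 addrC addKr.
    move=> ->; rewrite -mulrA mulr_suml; congr (_ * _); apply: eq_bigr => i _.
    by rewrite exprSr -!mulrA mulVf// mulr1.
  rewrite mulr_sumr; apply: eq_bigr => i _.
  by rewrite coef_poly ltn_ord -!mulrA mulVKf.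
- move=> i; rewrite coef_poly; case: ifP => _; last exact: subring0.
  by apply: subringM => //; exact: subringM.
- exact: size_poly.
Qed.

End MaximalAvoiding.
End Subrings.

Section IntegralClosure.
Variable D : idomainType.
Local Notation K := {fraction D}.
Implicit Types (x y z : K) (V : set K).

Lemma integralOver_spanP x :
  integralOver (@FracField.tofrac D) x <->
  exists n, power_span (base D) x n (x ^+ n).
Proof.
split.
- move=> [p mon_p /eqP px].
  exists (size p).-1, ('X^((size p).-1) - map_poly toK p).
  split.
  + move=> i; rewrite coefB coefXn coef_map /=.
    apply: (subringB (subring_base D)); last exact: baseK.
    by case: eqP => _; [exact: subring1 (subring_base D)
                       |exact: subring0 (subring_base D)].
  + apply/leq_sizeP => j jn; rewrite coefB coefXn coef_map.
    move: jn; rewrite leq_eqVlt => /predU1P[<-|jn].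
      by rewrite eqxx -lead_coefE (monicP mon_p) rmorph1 subrr.
    rewrite gtn_eqF// nth_default ?rmorph0 ?subrr//.
    by case: (size p) jn.
  + by rewrite hornerD hornerN hornerXn px subr0.
- move=> [n [p [Tp sp xn]]].
  have [d dE] := base_seq Tp.
  have sq : (size (- \poly_(i < n) d i) < size ('X^n : {poly D}))%N.
    by rewrite size_polyN size_polyXn ltnS size_poly.
  exists ('X^n - \poly_(i < n) d i).
    by rewrite monicE lead_coefDl// lead_coefXn.
  rewrite /root rmorphB/= map_polyXn hornerD hornerN hornerXn xn.
  rewrite (horner_coef_wide _ sp) (@horner_coef_wide _ n); last first.
    by rewrite (leq_trans (size_poly _ _))// size_poly.
  rewrite subr_eq0; apply/eqP/eq_bigr => i _.
  by rewrite coef_map coef_poly ltn_ord/= dE.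
Qed.

Lemma valuation_overring_avoiding x :
    integrally_closed D -> ~ base D x ->
  exists2 V, valuation_overring V & ~ V x.
Proof.
move=> icD nx.
have [|V avV Vmax] := exists_maximal_avoiding (subring_base D) (x := x).
  by move=> /integralOver_spanP /icD.
have x0 : x != 0.
  by apply: contra_not_neq nx => ->; exact: subring0 (subring_base D).
have valV := maximal_avoiding_valuation x0 avV Vmax.
by case: avV => *; exists V.
Qed.

(** An element x integral over a valuation ring V is in V[x^-1], which is V
    itself unless x is already in V. *)
Lemma integrally_closed_bigcap (W : set (set K)) :
    W `<=` @valuation_overring D -> base D = \bigcap_(V in W) V ->
  integrally_closed D.
Proof.
move=> Wval baseE x /integralOver_spanP[n xn]; rewrite baseE => V WV.
have [[ringV DV] valV] := Wval _ WV.
have [->|x0] := eqVneq x 0; first exact: subring0.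
have [//|Vx] := valV _ x0.
apply: (power_span_sub ringV Vx (n := n)); apply/(integral_invP ringV) => //.
by have [p [Dp sp e]] := xn; exists p; split=> // i; apply: DV.
Qed.

End IntegralClosure.

(** * Quasi-b-ideals and the maximum principle *)

Section BNoetherian.
Variable D : idomainType.
Local Notation K := {fraction D}.
Implicit Types (x y z : K) (V E F I J : set K).

Let ringD := subring_base D.

Definition valuation_module V E :=
  [/\ valuation_overring V, E 0, forall x y, E x -> E y -> E (x + y)
    & forall a x, V a -> E x -> E (a * x)].

(** The b-closure of I is contained in I V, hence in each V-module that contains
    I. *)
Lemma quasi_b_ideal_bigcap (A : set (set K * set K)) I :
    (forall V E, A (V, E) -> valuation_module V E) ->
    I = [set x | base D x /\ forall V E, A (V, E) -> E x] ->
    nonzero I -> quasi_b_ideal I.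
Proof.
move=> modA IE In0; have ID x : I x -> base D x by rewrite IE => -[].
have IA V E x : A (V, E) -> I x -> E x.
  by move=> AVE; rewrite IE => -[_ /(_ V E AVE)].
split=> //; first (split=> //; split).
  + rewrite IE; split; first exact: subring0.
    by move=> V E /modA[].
  + move=> x y Ix Iy; rewrite IE; split.
      by apply: subringD => //; exact: ID.
    by move=> V E AVE; case: (modA _ _ AVE) => _ _ + _; apply; exact: (IA V).
  + move=> d x Ix; rewrite IE; split.
      by apply: subringM => //; [exact: baseK|exact: ID].
    move=> V E AVE; case: (modA _ _ AVE) => -[[_ DV] _] _ _ EZ.
    by apply: EZ; [apply: DV; exact: baseK|exact: (IA V)].
- apply/seteqP; split=> [x [bIx Dx]|x Ix].
    rewrite IE; split=> // V E AVE; have [valV E0 ED EM] := modA _ _ AVE.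
    have [n [e [f [Ie Vf ->]]]] := bIx _ valV.
    apply: (big_ind E) => // i _; rewrite mulrC; apply: EM => //.
    exact: (IA V).
  split; last exact: ID.
  move=> V [[ringV _] _]; exists 1%N, (fun=> x), (fun=> 1); split=> // [_|].
    exact: subring1.
  by rewrite big_ord1 mulr1.
Qed.

(** Since D is the intersection of its valuation overrings V, the condition
    x y in D defining the colon ideal says that x is in every V-module
    y^-1 V. *)
Lemma quasi_b_ideal_colon E :
    integrally_closed D -> nonzero (base D `&` inv_set E) ->
  quasi_b_ideal (base D `&` inv_set E).
Proof.
move=> icD; apply: (@quasi_b_ideal_bigcap [set p | exists2 y, E y &
  valuation_overring p.1 /\ p.2 = [set x | p.1 (x * y)]]).
- move=> V M [y Ey [/= valV ->]]; have ringV : subring V by case: valV => -[].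
  split=> //=.
  + by rewrite mul0r; exact: subring0.
  + by move=> a b Va Vb; rewrite mulrDl; exact: subringD.
  + by move=> a b Va Vb; rewrite -mulrA; exact: subringM.
- apply/seteqP; split=> x [Dx Ex]; split=> //.
    move=> V M [y Ey [/= [[_ DV] _] ->]] /=; apply: DV; exact: Ex.
  move=> y Ey; apply: contrapT => /(valuation_overring_avoiding icD)[V valV].
  by apply; apply: (Ex V [set x | V (x * y)]); exists y.
Qed.

Lemma b_noetherian_maximal (S : set (set K)) :
    b_noetherian D -> S !=set0 -> S `<=` @quasi_b_ideal D ->
  exists2 I, S I & forall J, S J -> I `<=` J -> J `<=` I.
Proof.
move=> bN [I0 SI0] Sb; apply: contrapT => nmax.
have /choice[next nextP] : forall I, exists J,
    S I -> [/\ S J, I `<=` J & ~ J `<=` I].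
  move=> I; have [SI|] := pselect (S I); last by exists I.
  apply: contrapT => nJ; apply: nmax; exists I => // J SJ IJ.
  by apply: contrapT => JI; apply: nJ; exists J.
pose I n := iter n next I0.
have SI n : S (I n) by elim: n => //= n /nextP[].
have [||N Nstable] := bN I; first by move=> n; apply: Sb.
  by move=> n; have [] := nextP _ (SI n).
have [_ _] := nextP _ (SI N); apply.
by rewrite -[X in X `<=` _]/(I N.+1) Nstable.
Qed.

(** The chain used is that of the ideals d (D + D x)^n, enlarged to
    quasi-b-ideals: for a valuation overring V, the V-module d (V + V x)^n is
    d V if x is in V and d x^n V otherwise. *)
Lemma b_noetherian_completely_integrally_closed :
  b_noetherian D -> integrally_closed D -> completely_integrally_closed D.
Proof.
move=> bN icD x [d d0 dx].
have [->|x0] := eqVneq x 0; first exact: subring0.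
have td0 : toK d != 0 :> K by rewrite tofrac_eq0.
pose M n V := [set c : K | (V x -> V (c / toK d)) /\
                           (~ V x -> V (c / (toK d * x ^+ n)))].
pose I n := [set c | base D c /\ forall V, valuation_overring V -> M n V c].
have Mmod n V : valuation_overring V -> valuation_module V (M n V).
  move=> valV; have [[ringV _] _] := valV; split=> //.
  - by split=> _; rewrite mul0r; exact: subring0.
  - move=> a b [a1 a2] [b1 b2]; split=> Vx; rewrite mulrDl.
      by apply: subringD => //; [exact: a1|exact: b1].
    by apply: subringD => //; [exact: a2|exact: b2].
  - move=> a b Va [b1 b2]; split=> Vx; rewrite -mulrA.
      by apply: subringM => //; exact: b1.
    by apply: subringM => //; exact: b2.
have Vinv V : valuation_overring V -> ~ V x -> V x^-1.
  by move=> [_ valV] Vx; case: (valV _ x0).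
have Idx n : I n (toK d * x ^+ n).
  split=> // V valV; have [[ringV _] _] := valV; split=> Vx.
    by rewrite mulrAC divff// mul1r; exact: subringX.
  by rewrite divff ?mulf_neq0 ?expf_neq0//; exact: subring1.
have In n : quasi_b_ideal (I n).
  apply: (@quasi_b_ideal_bigcap
    [set p | valuation_overring p.1 /\ p.2 = M n p.1]).
  - by move=> V E /= [valV ->]; exact: Mmod.
  - apply/seteqP; split=> c [Dc Ic]; split=> //.
      by move=> V E /= [valV ->]; exact: Ic.
    by move=> V valV; apply: (Ic V).
  - by exists (toK d * x ^+ n); rewrite ?mulf_neq0 ?expf_neq0//; exact: Idx.
have Isub n : I n `<=` I n.+1.
  move=> c [Dc Ic]; split=> // V valV; have [[ringV _] _] := valV.
  have [i1 i2] := Ic V valV; split=> // Vx.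
  rewrite exprSr mulrA invfM mulrA; apply: subringM => //; last exact: Vinv.
  exact: i2.
have [N /(_ N.+1 (leqnSn N)) IN] := bN I In Isub.
apply: contrapT => /(valuation_overring_avoiding icD)[V valV Vx]; apply: Vx.
apply: contrapT => Vx.
have [_] : I N (toK d * x ^+ N.+1) by rewrite -IN; exact: Idx.
move=> /(_ V valV)[_ /(_ Vx)].
by rewrite exprSr mulrA mulrAC divff ?mulf_neq0 ?expf_neq0// mul1r.
Qed.

End BNoetherian.

(** * The v-operation and finitely generated ideals *)

Section Closures.
Variable D : idomainType.
Local Notation K := {fraction D}.
Implicit Types (x y z : K) (E F G I : set K).

Let ringD := subring_base D.

Lemma fractionP x : exists a b : D, b != 0 /\ x = toK a / toK b.
Proof.
elim/quotW: x => -[[a b] /= b0]; exists a, b; split => //.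
have tb0 : toK b != 0 :> K by rewrite tofrac_eq0.
apply: (mulIf tb0); rewrite mulfVK//; unlock FracField.tofrac.
rewrite -[LHS]FracField.pi_mul; apply/eqmodP => /=.
rewrite FracField.equivfE /FracField.mulf/= !numden_Ratio ?oner_neq0 ?mulr1//.
by rewrite mulrC.
Qed.

Lemma inv_setS E F : E `<=` F -> inv_set F `<=` inv_set E.
Proof. by move=> EF x Fx y /EF; exact: Fx. Qed.

Lemma sub_v_closure E : E `<=` v_closure E.
Proof. by move=> x Ex y Ey; rewrite mulrC; exact: Ey. Qed.

Lemma v_closure_eq_base E : inv_set E `<=` base D -> E `<=` base D ->
  v_closure E = base D.
Proof.
move=> iED ED; apply/seteqP; split=> x Dx.
  rewrite -(mulr1 x); apply: Dx => y Ey; rewrite mul1r; exact: ED.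
by move=> y /iED; exact: subringM.
Qed.

Lemma inv_set_v_closure E : v_closure E = base D -> inv_set E `<=` base D.
Proof.
move=> vE x Ex; have : v_closure E 1 by rewrite vE; exact: subring1.
by move=> /(_ x Ex); rewrite mul1r.
Qed.

Lemma prod_setM E F x y : E x -> F y -> prod_set E F (x * y).
Proof.
by move=> Ex Fy; exists 1%N, (fun=> x), (fun=> y); split=> //; rewrite big_ord1.
Qed.

Lemma prod_inv_set_sub F : prod_set F (inv_set F) `<=` base D.
Proof.
move=> _ [n [e [f [Fe Ff ->]]]]; apply: subring_sum => // i.
by rewrite mulrC; exact: Ff.
Qed.

Lemma submodule_prod_set E F :
  submodule E -> submodule (prod_set E F).
Proof.
move=> [E0 ED EZ]; split.
- exists 0%N, (fun=> 0), (fun=> 0); split; first by case.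
    by case.
  by rewrite big_ord0.
- move=> _ _ [n1 [e1 [f1 [Ee1 Ff1 ->]]]] [n2 [e2 [f2 [Ee2 Ff2 ->]]]].
  pose cat (a1 : 'I_n1 -> K) (a2 : 'I_n2 -> K) i :=
    match fintype.split i with inl j => a1 j | inr k => a2 k end.
  exists (n1 + n2)%N, (cat e1 e2), (cat f1 f2); split.
  + by move=> i; rewrite /cat; case: fintype.split.
  + by move=> i; rewrite /cat; case: fintype.split.
  + rewrite big_split_ord; congr (_ + _); apply: eq_bigr => i _; rewrite /cat.
      by rewrite (unsplitK (inl _ i)).
    by rewrite (unsplitK (inr _ i)).
- move=> d _ [n [e [f [Ee Ff ->]]]].
  exists n, (fun i => toK d * e i), f; split=> // [i|]; first exact: EZ.
  by rewrite mulr_sumr; apply: eq_bigr => i _; rewrite mulrA.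
Qed.

Definition generated n (a : 'I_n -> K) : set K :=
  [set x | exists c : 'I_n -> D, x = \sum_(i < n) toK (c i) * a i].

Lemma submodule_generated n (a : 'I_n -> K) : submodule (generated a).
Proof.
split.
- by exists (fun=> 0); rewrite big1// => i _; rewrite rmorph0 mul0r.
- move=> _ _ [c ->] [c' ->]; exists (fun i => c i + c' i).
  by rewrite -big_split; apply: eq_bigr => i _; rewrite rmorphD mulrDl.
- move=> d _ [c ->]; exists (fun i => d * c i).
  by rewrite mulr_sumr; apply: eq_bigr => i _; rewrite rmorphM mulrA.
Qed.

Lemma generated_sub n (a : 'I_n -> K) E :
  submodule E -> (forall i, E (a i)) -> generated a `<=` E.
Proof.
move=> [E0 ED EZ] Ea _ [c ->]; apply: (big_ind E) => // i _; exact: EZ.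
Qed.

Lemma generated_cons n (a : 'I_n -> K) z E :
    submodule E -> E z -> (forall i, E (a i)) ->
  exists a' : 'I_n.+1 -> K,
    [/\ forall i, E (a' i), generated a' z & generated a `<=` generated a'].
Proof.
move=> subE Ez Ea; exists (fun i => if unlift ord0 i is Some j then a j else z).
split.
- by move=> i; case: unliftP.
- exists (fun i => (i == ord0)%:R).
  rewrite big_ord_recl eqxx rmorph1 mul1r unlift_none big1 ?addr0// => i _.
  by rewrite -[_ == _]/false rmorph0 mul0r.
- move=> _ [c ->]; exists (fun i => if unlift ord0 i is Some j then c j else 0).
  rewrite big_ord_recl !unlift_none rmorph0 mul0r add0r.
  by apply: eq_bigr => i _; rewrite !liftK.
Qed.

(** The inverse of F F^-1 maps F^-1 into itself, so all powers of its elements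
    have a common denominator, namely any nonzero element of F F^-1. *)
Lemma completely_integrally_closed_v_domain :
  completely_integrally_closed D -> v_domain D.
Proof.
move=> cicD F [[[F0 _ FZ] [d d0 Fd]] [f Ff f0] _].
apply: v_closure_eq_base; last exact: prod_inv_set_sub.
move=> x xI; have [e _ ef] := Fd f Ff.
have step y : inv_set F y -> inv_set F (x * y).
  move=> Fy g Fg; rewrite -mulrA [y * g]mulrC; apply: xI; exact: prod_setM.
have xd n : inv_set F (x ^+ n * toK d).
  elim: n => [|n IHn]; first by rewrite expr0 mul1r.
  by rewrite exprS -mulrA; exact: step.
apply: cicD; exists e.
  by rewrite -tofrac_eq0 ef mulf_neq0 // tofrac_eq0.
by move=> n; rewrite ef mulrC mulrA; exact: xd.
Qed.

(** If x is integral, then F = D[x] is finitely generated and x F is contained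
    in F, so that x belongs to the inverse of F F^-1, which is D. *)
Lemma v_domain_integrally_closed : v_domain D -> integrally_closed D.
Proof.
move=> vD x /integralOver_spanP[n intx].
have n0 : (0 < n)%N.
  case: n intx => // -[p [_]]; rewrite leqn0 size_poly_eq0 => /eqP->.
  by rewrite horner0 expr0 => /eqP; rewrite oner_eq0.
pose F := generated (fun i : 'I_n => x ^+ i).
have FE : F = power_span (base D) x n.
  apply/seteqP; split=> y.
    move=> [c ->].
    exists (\poly_(i < n) (if insub i is Some j then toK (c j) else 0)).
    split; last 1 first.
    - rewrite (horner_coef_wide _ (size_poly _ _)); apply: eq_bigr => i _.
      by rewrite coef_poly ltn_ord valK.
    - move=> i; rewrite coef_poly; case: ifP => _; last exact: subring0.
      by case: insub => [j|]; [exact: baseK|exact: subring0].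
    - exact: size_poly.
  move=> [p [Dp sp ->]].
  have [d dE] := base_seq Dp.
  exists (fun i => d i); rewrite (horner_coef_wide _ sp).
  by apply: eq_bigr => i _; rewrite dE.
have Fx y : F y -> F (x * y).
  rewrite FE => Fy; apply: adjoin_integral => //; apply: subringM.
  - exact: adjoin_subring.
  - exact: mem_adjoin.
  - by exists n.
have nzF : nonzero_fg_fractional_ideal F.
  split; last by exists n, (fun i => x ^+ i).
    split; first exact: submodule_generated.
    have [a [b [b0 xE]]] := fractionP x.
    exists (b ^+ n); first by rewrite expf_neq0.
    move=> _ [c ->]; rewrite mulr_sumr; apply: subring_sum => // i.
    rewrite mulrCA; apply: subringM => //; first exact: baseK.
    have -> : b ^+ n = b ^+ (n - i) * b ^+ i by rewrite -exprD subnK// ltnW.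
    rewrite rmorphM -mulrA.
    apply: subringM => //; first exact: baseK.
    rewrite rmorphXn -exprMn xE mulrC mulfVK ?tofrac_eq0//.
    by apply: subringX => //; exact: baseK.
  exists 1; last exact: oner_neq0.
  exists (fun i => (i == Ordinal n0)%:R).
  rewrite (bigD1 (Ordinal n0))// eqxx rmorph1 mul1r expr0.
  rewrite big1 => [|i /negbTE->].
    by rewrite /= addr0.
  by rewrite rmorph0 mul0r.
apply: (inv_set_v_closure (vD F nzF)) => _ [m [e [f [Fe Ff ->]]]].
rewrite mulr_sumr; apply: subring_sum => // i.
by rewrite mulrA mulrC; apply: Ff; exact: Fx.
Qed.

(** Take G inside I finitely generated with its divisorial closure maximal:
    adding one more element of I to G does not enlarge this closure, which
    therefore contains I. *)
Lemma finite_type_inv_set I :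
    b_noetherian D -> integrally_closed D ->
    submodule I -> nonzero I -> I `<=` base D ->
  exists2 G, nonzero_fg_fractional_ideal G /\ G `<=` I
           & inv_set G `<=` inv_set I.
Proof.
move=> bN icD subI [g Ig g0] ID.
have nzfg n (a : 'I_n -> K) y :
    (forall i, I (a i)) -> generated a y -> y != 0 ->
    nonzero_fg_fractional_ideal (generated a).
  move=> Ia ay y0; split; [|by exists y|by exists n, a].
  split; first exact: submodule_generated.
  exists 1; first exact: oner_neq0.
  by move=> z az; rewrite rmorph1 mul1r; apply: ID; exact: generated_sub az.
(* A fixed nonzero g is kept among the generated elements so that all the ideals
   considered are nonzero. *)
pose S := [set J | exists n (a : 'I_n -> K),
  [/\ forall i, I (a i), generated a g
    & J = base D `&` v_closure (generated a)]].
have [J [n [a [Ia ag JE]]] Jmax] :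
    exists2 J, S J & forall J', S J' -> J `<=` J' -> J' `<=` J.
  apply: b_noetherian_maximal => //.
    exists (base D `&` v_closure (generated (fun _ : 'I_1 => g))).
    exists 1%N, (fun=> g); split=> //; exists (fun=> 1).
    by rewrite big_ord1 rmorph1 mul1r.
  move=> _ [n [a [Ia ag ->]]]; apply: quasi_b_ideal_colon => //.
  by exists g => //; split; [exact: ID|exact: sub_v_closure].
exists (generated a).
  by split; [exact: nzfg ag _|exact: generated_sub].
have Iv : I `<=` v_closure (generated a).
  move=> z Iz; have [a' [Ia' a'z aa']] := generated_cons subI Iz Ia.
  suff : J z by rewrite JE => -[].
  apply: (Jmax (base D `&` v_closure (generated a'))).
  - by exists n.+1, a'; split=> //; exact: aa'.
  - by rewrite JE; apply: setIS; do 2 apply: inv_setS.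
  - by split; [exact: ID|exact: sub_v_closure].
by move=> x ax z /Iv; rewrite mulrC; apply.
Qed.

(** A finitely generated G inside F F^-1 with the same inverse D satisfies
    G^v = D. *)
Lemma v_domain_PvMD : b_noetherian D -> v_domain D -> PvMD D.
Proof.
move=> bN vD F nzF; have [[subF [d d0 Fd]] [f Ff f0] _] := nzF.
have icD := v_domain_integrally_closed vD.
have vI := vD F nzF.
have [|G [nzG GI] iGI] := finite_type_inv_set bN icD
    (submodule_prod_set (inv_set F) subF) _ (@prod_inv_set_sub F).
  exists (f * toK d); last by rewrite mulf_neq0 ?tofrac_eq0.
  exact: prod_setM.
apply/seteqP; split=> x.
  by move=> [H [_ HI] Hx]; rewrite -vI; move: Hx; do 2 apply: inv_setS.
move=> Dx; exists G => // y /iGI /(inv_set_v_closure vI); exact: subringM.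
Qed.

Lemma PvMD_v_domain : PvMD D -> v_domain D.
Proof.
move=> pD F nzF; apply: v_closure_eq_base; last exact: prod_inv_set_sub.
move=> x xI; have [G [_ GI] G1] : t_closure (prod_set F (inv_set F)) 1.
  by rewrite pD//; exact: subring1.
by have := G1 x (inv_setS GI xI); rewrite mul1r.
Qed.

End Closures.

(** * Localization at a maximal ideal of denominators *)

Section Krull.
Variable D : idomainType.
Local Notation K := {fraction D}.
Implicit Types (x y z a b c : K) (V : set K).

Let ringD := subring_base D.

Definition denominators x : set K := base D `&` inv_set [set x].

Lemma denominatorsP x d : denominators x d <-> base D d /\ base D (d * x).
Proof.
split=> [[Dd xd]|[Dd xd]]; split=> //; first exact: xd.
by move=> _ ->.
Qed.

Lemma denominators_nonzero x : nonzero (denominators x).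
Proof.
have [a [b [b0 ->]]] := fractionP x.
have tb0 : toK b != 0 :> K by rewrite tofrac_eq0.
exists (toK b) => //; apply/denominatorsP; split; first exact: baseK.
by rewrite mulrC mulfVK//; exact: baseK.
Qed.

(** The maximal ideals of denominators are the maximal proper divisorial ideals
    of D; they are indexed here by the elements y that define them, since y^-1
    is a uniformizer of the localization when D is completely integrally closed. *)
Definition critical y :=
  ~ base D y /\ forall z, ~ base D z ->
    denominators y `<=` denominators z -> denominators z `<=` denominators y.

Lemma exists_critical x :
    b_noetherian D -> integrally_closed D -> ~ base D x ->
  exists2 y, critical y & denominators x `<=` denominators y.
Proof.
move=> bN icD nx.
pose S := [set J | exists z,
  [/\ ~ base D z, denominators x `<=` denominators z & J = denominators z]].
have [||_ [y [ny xy ->]] ymax] := @b_noetherian_maximal D S bN.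
- by exists (denominators x); exists x; split.
- move=> _ [z [_ _ ->]]; apply: quasi_b_ideal_colon => //.
  exact: denominators_nonzero.
exists y => //; split=> // z nz yz; apply: (ymax (denominators z)) => //.
by exists z; split=> //; exact: subset_trans xy yz.
Qed.

(** For b in D, the condition that b y is not in D says that b is outside the
    ideal of denominators P of y.  So this is D_P, and [local_unit] is its
    group of units. *)
Definition localization y : set K :=
  [set x | exists a b, [/\ base D a, base D b, ~ base D (b * y) & x = a / b]].

Definition local_unit y : set K :=
  [set x | exists a b, [/\ base D a, base D b, ~ base D (a * y),
    ~ base D (b * y) & x = a / b]].

Section Critical.
Variables (y : K) (crit_y : critical y).

Let ny : ~ base D y. Proof. by case: crit_y. Qed.

Lemma nonmember_neq0 b : ~ base D (b * y) -> b != 0.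
Proof. by apply: contra_not_neq => ->; rewrite mul0r; exact: subring0. Qed.

(** If b is not in P = (D : y), then b y is not in D and (D : b y) contains P,
    hence equals P by maximality; and a b in P means that a is in (D : b y). *)
Lemma denominators_prime a b : base D a -> base D b ->
  ~ base D (a * y) -> ~ base D (b * y) -> ~ base D (a * b * y).
Proof.
move=> Da Db na nb Dab; apply: na; have [_ ymax] := crit_y.
suff /denominatorsP[] : denominators y a by [].
apply: (ymax (b * y)) => //.
  move=> c /denominatorsP[Dc cy]; apply/denominatorsP; split=> //.
  by rewrite mulrCA; exact: subringM.
by apply/denominatorsP; split=> //; rewrite mulrA.
Qed.

Lemma prime_exp b n : base D b -> ~ base D (b * y) -> ~ base D (b ^+ n * y).
Proof.
move=> Db nb; elim: n => [|n IHn]; first by rewrite expr0 mul1r.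
by rewrite exprS; apply: denominators_prime => //; exact: subringX.
Qed.

Lemma base_sub_localization : base D `<=` localization y.
Proof.
move=> a Da; exists a, 1; rewrite mul1r divr1; split=> //; exact: subring1.
Qed.

Lemma critical_notin_localization : ~ localization y y.
Proof.
move=> [a [b [Da Db nb e]]]; apply: (nb).
by rewrite [in X in _ * X]e mulrC mulfVK// (nonmember_neq0 nb).
Qed.

Lemma local_unit_localization x : local_unit y x -> localization y x.
Proof. by move=> [a [b [*]]]; exists a, b. Qed.

Lemma local_unit1 : local_unit y 1.
Proof. by exists 1, 1; rewrite mul1r divr1; split=> //; exact: subring1. Qed.

Lemma local_unitM u v :
  local_unit y u -> local_unit y v -> local_unit y (u * v).
Proof.
move=> [a [b [Da Db na nb ->]]] [c [d [Dc Dd nc nd ->]]].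
exists (a * c), (b * d); split; [exact: subringM|exact: subringM| | |].
- exact: denominators_prime.
- exact: denominators_prime.
- by rewrite mulf_div.
Qed.

Lemma local_unitV u : local_unit y u -> local_unit y u^-1.
Proof. by move=> [a [b [Da Db na nb ->]]]; exists b, a; rewrite invf_div. Qed.

Lemma subring_localization : subring (localization y).
Proof.
split; first by apply: base_sub_localization; exact: subring1.
- move=> _ _ [a [b [Da Db nb ->]]] [c [d [Dc Dd nd ->]]].
  exists (a * d - c * b), (b * d); split.
  + by apply: subringB => //; exact: subringM.
  + exact: subringM.
  + exact: denominators_prime.
  + by rewrite -mulNr addf_div ?nonmember_neq0// mulNr.
- move=> _ _ [a [b [Da Db nb ->]]] [c [d [Dc Dd nd ->]]].
  exists (a * c), (b * d); split; [exact: subringM|exact: subringM| |].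
    exact: denominators_prime.
  by rewrite mulf_div.
Qed.

Hypothesis cicD : completely_integrally_closed D.

(** Otherwise multiplication by y would map P into itself, and all d y^n with d
    in P would be in D, making y almost integral. *)
Lemma exists_uniformizer :
  exists p, [/\ base D p, base D (p * y) & ~ base D (p * y * y)].
Proof.
apply: contrapT => nop; apply: ny; apply: cicD.
have [_ /denominatorsP[[d _ <-] dy] d0] := denominators_nonzero y.
exists d; first by rewrite -tofrac_eq0.
move=> n.
suff [] : base D (toK d * y ^+ n) /\ base D (toK d * y ^+ n * y) by [].
elim: n => [|n [Dn Dny]].
  by rewrite expr0 mulr1; split=> //; exact: baseK.
rewrite exprSr mulrA; split=> //; apply: contrapT => nDny.
by apply: nop; exists (toK d * y ^+ n).
Qed.

Let y0 : y != 0.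
Proof. by apply: contra_not_neq ny => ->; exact: subring0. Qed.

Lemma localization_inv : localization y y^-1.
Proof.
have [p [Dp Du nu]] := exists_uniformizer; exists p, (p * y); split=> //.
rewrite invfM mulrA divff ?mul1r//.
by apply: contra_not_neq nu => ->; rewrite !mul0r; exact: subring0.
Qed.

(** Writing y = u / p with p in P and u outside P, an equality y^k = a / b reads
    b u^k = p^k a; for k > 0 the right side is in the prime P, which forces b
    into P. *)
Lemma local_unit_exp_eq0 (n : int) : local_unit y (y ^ n) -> n = 0.
Proof.
have pos (k : nat) : ~ local_unit y (y ^+ k.+1).
  move=> [a [b [Da Db na nb e]]].
  have [p [Dp Du nu]] := exists_uniformizer.
  have : ~ base D (b * (p * y) ^+ k.+1 * y).
    apply: denominators_prime => //; first exact: subringX.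
    exact: prime_exp.
  apply; have -> : b * (p * y) ^+ k.+1 * y = p ^+ k * a * (p * y).
    rewrite exprMn e exprS; have := nonmember_neq0 nb; move: (p ^+ k) => pk b0.
    by field.
  by do 2 apply: subringM => //; exact: subringX.
case: n => [[|k]|k] //; first by move=> /pos.
by rewrite NegzE -exprnN => /local_unitV; rewrite invrK => /pos.
Qed.

(** Complete integral closedness bounds the n for which x y^n is in D.  Just
    before the first failure n + 1, x y^n is an element of D outside P. *)
Lemma exists_local_exp_base x : base D x -> x != 0 ->
  exists n : nat, local_unit y (x * y ^+ n).
Proof.
move=> Dx x0.
have exn : exists n, ~~ `[< base D (x * y ^+ n) >].
  apply: contrapT => nexn; apply: ny; apply: cicD.
  case: Dx x0 nexn => d _ <- d0 nexn; exists d; first by rewrite -tofrac_eq0.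
  move=> n; apply: contrapT => nn; apply: nexn; exists n.
  by apply/negP => /asboolP.
case: (ex_minnP exn) => -[|n].
  by rewrite expr0 mulr1 => /negP[]; apply/asboolP.
move=> /negP nn1 /(_ n); rewrite ltnn => nn.
exists n, (x * y ^+ n), 1; rewrite mul1r divr1; split=> //.
- apply: contrapT => nDn; suff: false by [].
  by apply: nn; apply/negP => /asboolP.
- exact: subring1.
- by rewrite -mulrA -exprSr => /asboolP.
Qed.

Lemma exists_local_exp x : x != 0 -> exists n : int, local_unit y (x * y ^ n).
Proof.
have [a [b [b0 ->]]] := fractionP x.
rewrite mulf_eq0 invr_eq0 !tofrac_eq0 negb_or => /andP[a0 _].
have [||n an] := @exists_local_exp_base (toK a); rewrite ?tofrac_eq0//.
  exact: baseK.
have [||m bm] := @exists_local_exp_base (toK b); rewrite ?tofrac_eq0//.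
  exact: baseK.
exists (n%:Z - m%:Z); have := local_unitM an (local_unitV bm).
by rewrite expfzDr// -exprnN invfM mulrACA.
Qed.

(** The valuation of D_P normalized by the value -1 at y: the value of x is the
    exponent of y needed to make x a unit. *)
Definition local_exp x : int := xget 0 [set n : int | local_unit y (x * y ^ n)].

Lemma local_expP x n : x != 0 -> (local_exp x = n) <-> local_unit y (x * y ^ n).
Proof.
move=> x0.
have un : local_unit y (x * y ^ local_exp x).
  rewrite /local_exp; case: xgetP => // nex.
  by have [m xm] := exists_local_exp x0; have := nex m.
split=> [<-//|xn]; apply/eqP; rewrite -subr_eq0; apply/eqP/local_unit_exp_eq0.
rewrite expfzDr// -invr_expz.
have := local_unitM un (local_unitV xn).
by rewrite invfM mulrACA divff// mul1r.
Qed.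

Lemma local_exp_spec x : x != 0 -> local_unit y (x * y ^ local_exp x).
Proof. by move=> x0; apply/local_expP. Qed.

Lemma localizationE :
  localization y = [set x | x = 0 \/ 0 <= local_exp x].
Proof.
apply/seteqP; split=> x.
  move=> [a [b [Da Db nb ->]]].
  have [->|a0] := eqVneq a 0; first by left; rewrite mul0r.
  right; have [n an] := exists_local_exp_base Da a0.
  suff -> : local_exp (a / b) = n by [].
  apply/local_expP; first by rewrite mulf_neq0// invr_eq0 nonmember_neq0.
  rewrite mulrAC; apply: local_unitM => //.
  by exists 1, b; rewrite !mul1r; split=> //; exact: subring1.
have [->|x0 [x00|]] := eqVneq x 0.
- by move=> _; apply: base_sub_localization; exact: subring0.
- by rewrite x00 eqxx in x0.
have := local_exp_spec x0.
case: (local_exp x) => // n /local_unit_localization xn _.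
have : localization y (x * y ^+ n * (y^-1) ^+ n).
  apply: (subringM subring_localization) => //.
  by apply: (subringX subring_localization); exact: localization_inv.
by rewrite exprVn mulfK// expf_neq0.
Qed.

Lemma local_expM a b : a != 0 -> b != 0 ->
  local_exp (a * b) = local_exp a + local_exp b.
Proof.
move=> a0 b0; apply/local_expP; first by rewrite mulf_neq0.
by rewrite expfzDr// mulrACA; apply: local_unitM; exact: local_exp_spec.
Qed.

(** The ultrametric inequality follows from D_P being a ring: if the value of b
    is at least that of a, then 1 + b / a is in D_P. *)
Lemma localization_dvr : discrete_valuation_ring (localization y).
Proof.
exists local_exp; last exact: localizationE.
split; first exact: local_expM.
- move=> a b a0 b0 ab0.
  wlog le_ab : a b a0 b0 ab0 / local_exp a <= local_exp b.
    move=> wl; have [le|/ltW le] := leP (local_exp a) (local_exp b).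
      by have := wl a b a0 b0 ab0 le; rewrite (min_idPl le).
    have := wl b a b0 a0; rewrite addrC => /(_ ab0 le).
    by rewrite (min_idPl le).
  rewrite (min_idPl le_ab).
  have ba0 : b / a != 0 by rewrite mulf_neq0// invr_eq0.
  have le_ba : 0 <= local_exp (b / a).
    by rewrite -(lerD2l (local_exp a)) addr0 -local_expM// mulrC mulfVK.
  have : localization y (1 + b / a).
    apply: (subringD subring_localization).
      exact: (subring1 subring_localization).
    by rewrite localizationE; right.
  have abE : a + b = a * (1 + b / a) by rewrite mulrDr mulr1 mulrC mulfVK.
  have ab1 : 1 + b / a != 0.
    by move: ab0; rewrite abE mulf_eq0 negb_or => /andP[].
  rewrite localizationE => -[/eqP|]; first by rewrite (negbTE ab1).
  by rewrite abE local_expM// lerDl.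
- exists y^-1; first by rewrite invr_eq0.
  apply/local_expP; rewrite ?invr_eq0// expr1z mulVf//; exact: local_unit1.
Qed.

End Critical.

(** * Krull domains *)

Lemma dvr_valuation_overring V :
  discrete_valuation_ring V -> base D `<=` V -> valuation_overring V.
Proof.
move=> [w [wM wD _] VE] DV.
have w1 : w 1 = 0.
  by apply: (@addrI _ (w 1)); rewrite -wM ?oner_neq0// mulr1 addr0.
have wN x : x != 0 -> w (- x) = w x.
  move=> x0; have N1 : (-1 : K) != 0 by rewrite oppr_eq0 oner_neq0.
  suff wN1 : w (-1) = 0 by rewrite -mulN1r wM// wN1 add0r.
  have := wM _ _ N1 N1; rewrite mulrNN mulr1 w1 => /esym /eqP.
  by rewrite -mulr2n mulrn_eq0 => /eqP.
split; last first.
  move=> x x0; have : w x + w x^-1 = 0 by rewrite -wM ?invr_eq0// divff.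
  rewrite VE /=; have [le0|/ltW le0] := leP 0 (w x); first by left; right.
  move=> /eqP; rewrite addrC addr_eq0 => /eqP e.
  by right; right; rewrite e oppr_ge0.
split=> //; split; first by apply: DV; exact: subring1.
- move=> a b; rewrite VE /= => -[->|wa].
    move=> -[->|wb]; first by left; rewrite subrr.
    have [->|b0] := eqVneq b 0; first by left; rewrite subrr.
    by right; rewrite sub0r wN.
  move=> [->|wb]; first by right; rewrite subr0.
  have [->|a0] := eqVneq a 0.
    have [->|b0] := eqVneq b 0; first by left; rewrite subrr.
    by right; rewrite sub0r wN.
  have [->|b0] := eqVneq b 0; first by right; rewrite subr0.
  have [ab0|ab0] := eqVneq (a - b) 0; [by left|right].
  apply: le_trans (wD _ _ a0 _ ab0); last by rewrite oppr_eq0.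
  by rewrite wN// le_min wa wb.
- move=> a b; rewrite VE /= => -[->|wa]; first by left; rewrite mul0r.
  move=> [->|wb]; first by left; rewrite mulr0.
  have [->|a0] := eqVneq a 0; first by left; rewrite mul0r.
  have [->|b0] := eqVneq b 0; first by left; rewrite mulr0.
  by right; rewrite wM// addr_ge0.
Qed.

(** Distinct maximal ideals of denominators are incomparable: some c in (D : y)
    is outside (D : z), and then y = (c y) / c.  So y is integral at all the
    localizations but its own. *)
Lemma localization_eq_or_mem y z : critical y -> critical z ->
  localization y = localization z \/ localization z y.
Proof.
move=> cy cz; have [yz|] := pselect (denominators y `<=` denominators z).
  left; have [_ ymax] := cy.
  have zy := ymax _ cz.1 yz.
  have iff b : base D b -> base D (b * y) <-> base D (b * z).
    move=> Db; split=> h.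
      by have /denominatorsP[] : denominators z b by apply/yz/denominatorsP.
    by have /denominatorsP[] : denominators y b by apply/zy/denominatorsP.
  apply/seteqP; split=> x [a [b [Da Db nb ->]]]; exists a, b; split=> //.
    by rewrite -iff.
  by rewrite iff.
move=> nyz; right; apply: contrapT => nzy.
apply: nyz => c /denominatorsP[Dc cy'].
apply/denominatorsP; split=> //; apply: contrapT => ncz; apply: nzy.
exists (c * y), c; split=> //.
by rewrite mulrC mulKf// (nonmember_neq0 ncz).
Qed.

Lemma b_noetherian_krull_domain : b_noetherian D -> integrally_closed D ->
  krull_domain D.
Proof.
move=> bN icD; have cicD := b_noetherian_completely_integrally_closed bN icD.
pose W := [set V | exists2 y, critical y & V = localization y].
have valW V : W V -> valuation_overring V.
  move=> [y cy ->]; apply: dvr_valuation_overring.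
    exact: localization_dvr.
  exact: base_sub_localization.
exists W; split.
- by move=> V [y cy ->]; exact: localization_dvr.
- apply/seteqP; split=> x.
    by move=> Dx V [y cy ->]; exact: base_sub_localization.
  move=> Wx; apply: contrapT => nx.
  have [y cy xy] := exists_critical bN icD nx.
  have [|a [b [Da Db nb e]]] := Wx (localization y); first by exists y.
  apply: (nb); have /denominatorsP[//] : denominators y b.
  apply/xy/denominatorsP.
  by rewrite e mulrC mulfVK// (nonmember_neq0 nb).
(* B consists of the rings in which x is not a unit.  The ideals J S increase
   when S shrinks, so a maximal J S over the cofinite subsets S of B is used to
   show that S is empty. *)
move=> x Dx x0; set B := [set V | _].
pose J (S : set (set K)) := [set c | base D c /\ forall V, S V -> V (c / x)].
pose cofinite S := S `<=` B /\ finite_set (B `\` S).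
have qJ S : S `<=` B -> quasi_b_ideal (J S).
  move=> SB; apply: (@quasi_b_ideal_bigcap D
    [set p | S p.1 /\ p.2 = [set c | p.1 (c / x)]]).
  - move=> V E /= [SV ->]; have [WV _] := SB _ SV.
    have valV := valW _ WV; have ringV : subring V by case: valV => -[].
    split=> //=.
    + by rewrite mul0r; exact: subring0.
    + by move=> a b Va Vb; rewrite mulrDl; exact: subringD.
    + by move=> a b Va Vb; rewrite -mulrA; exact: subringM.
  - apply/seteqP; split=> c [Dc Sc]; split=> //.
      by move=> V E /= [SV ->]; exact: Sc.
    by move=> V SV; exact: (Sc V [set c | V (c / x)]).
  - exists x => //; split=> // V SV; rewrite divff//.
    by apply: subring1; have [WV _] := SB _ SV; case: (valW _ WV) => -[].
have [||_ [S [SB finS] ->] Smax] :=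
    @b_noetherian_maximal D [set I | exists2 S, cofinite S & I = J S] bN.
- by exists (J B), B => //; split=> //; rewrite setDv.
- by move=> _ [S [SB _] ->]; exact: qJ.
suff S0 : S = set0 by move: finS; rewrite S0 setD0.
rewrite -subset0 => V SV; have [[y cy VE] Vx] := SB _ SV.
have Dxy : base D (x * y).
  apply: contrapT => nxy; apply: Vx; rewrite VE.
  by exists 1, x; rewrite mul1r; split=> //; exact: subring1.
have /Smax sub : [set I | exists2 S, cofinite S & I = J S] (J (S `\ V)).
  exists (S `\ V) => //; split; first by move=> U [/SB].
  apply: (@sub_finite_set _ _ ((B `\` S) `|` [set V])); last first.
    by rewrite finite_setU; split=> //; exact: finite_set1.
  move=> U [BU SVU]; have [->|UV] := pselect (U = V); first by right.
  by left; split=> // SU; apply: SVU; split.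
(* x y is in x V for every V in S except the localization at y. *)
have : J S (x * y).
  apply: sub; first by move=> c [Dc Sc]; split=> // U [SU _]; exact: Sc.
  split=> // U [SU UV]; have [[z cz UE] _] := SB _ SU.
  rewrite mulrAC divff// mul1r UE.
  have [e|//] := localization_eq_or_mem cy cz.
  by exfalso; apply: UV; rewrite UE -e.
move=> [_ /(_ V SV)]; rewrite mulrAC divff// mul1r VE.
exact: critical_notin_localization.
Qed.

Lemma krull_domain_integrally_closed : krull_domain D -> integrally_closed D.
Proof.
move=> [W [Wdvr DE _]]; apply: (@integrally_closed_bigcap D W) => // V WV.
apply: dvr_valuation_overring; first exact: Wdvr.
by rewrite DE => x; apply.
Qed.

End Krull.

Theorem theorem21 (D : idomainType) (bN : b_noetherian D) :
  [<-> integrally_closed D;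
       completely_integrally_closed D;
       v_domain D;
       PvMD D;
       krull_domain D].
Proof.
tfae.
- exact: b_noetherian_completely_integrally_closed.
- exact: completely_integrally_closed_v_domain.
- exact: v_domain_PvMD.
- move=> /PvMD_v_domain /v_domain_integrally_closed.
  exact: b_noetherian_krull_domain.
- exact: krull_domain_integrally_closed.
Qed.
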